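(* Let $\mathbf{X}=\{X_1,\ldots,X_n\}$ be a set of random variables, with Bayesian-network structures, likelihoods and parameter priors as described in the context. Given global parameter independence, prior modularity, covered-arc-reversal equivalence and marginal likelihood equivalence, we can construct the prior $p(\theta_s\mid S^h)$ for any structure $S$ for $\mathbf{X}$ given the prior $p(\theta_{sc}\mid S_c^h)$ for any complete structure $S_c$ for $\mathbf{X}$.
   Context: **Structures.** A structure $S$ for $\mathbf{X}=\{X_1,\ldots,X_n\}$ is a directed acyclic graph with node set $\mathbf{X}$; $\mathbf{Pa}_i^S$ (or $\mathbf{Pa}_i$) is the set of parents of $X_i$ in $S$. With the variables ordered so that parents precede children, $S$ represents the conditional-independence assertions that each $X_i$ is independent of its non-parent predecessors given its parents. Two structures are independence equivalent if they represent the same assertions of conditional independence. A structure is complete if it has no missing arcs; all complete structures for $\mathbf{X}$ are independence equivalent. An arc between two nodes is covered if those two nodes would have the same parents if the arc were removed; a covered arc reversal reverses a single covered arc. **Likelihoods and priors.** $\mathbf{x}$ denotes a value of $\mathbf{X}$, $x_i$ a value of $X_i$, and $\mathbf{pa}_i$ a value of the parent set of $X_i$ in $S$. $S^h$ is the hypothesis that the joint distribution of $\mathbf{X}$ factors according to $S$; every structure hypothesis is possible, i.e. $p(S^h)>0$ for all $S$. For each $S$ there is a finite set of parameters $\theta_s=(\theta_1,\ldots,\theta_n)$, assumed absolutely continuous, with prior density $p(\theta_s\mid S^h)$ having marginal densities $p(\theta_i\mid S^h)$, and the likelihood is $p(\mathbf{x}\mid\theta_s,S^h)=\prod_{i=1}^n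 p(x_i\mid\mathbf{pa}_i,\theta_i,S^h)$. The local likelihoods $p(x_i\mid\mathbf{pa}_i,\theta_i,S^h)$ are restricted to some family $\mathcal F$ of probability distributions. **Global parameter independence.** For any structure $S$ for $\mathbf{X}$, $p(\theta_s\mid S^h)=\prod_{i=1}^n p(\theta_i\mid S^h)$. **Prior modularity.** For any two structures $S_1,S_2$ for $\mathbf{X}$ such that $X_i$ has the same parents in $S_1$ and $S_2$, $p(\theta_i\mid S_1^h)=p(\theta_i\mid S_2^h)$. **Covered-arc-reversal equivalence.** Any two structures for $\mathbf{X}$ that differ by a single covered arc reversal are distribution equivalent with respect to $\mathcal F$. Here $S_1,S_2$ are distribution equivalent with respect to $\mathcal F$ if for every $\theta_{s1}$ there is a $\theta_{s2}$ with $p(\mathbf{x}\mid\theta_{s1},S_1^h)=p(\mathbf{x}\mid\theta_{s2},S_2^h)$, and vice versa. (Since independence-equivalent structures can be transformed into each other by covered arc reversals, independence-equivalent structures are then distribution equivalent.) **Technical assumptions.** The parameters $\theta_i$ are uniquely determined given the local likelihood of $X_i$. Consequently, for distribution-equivalent $S_1,S_2$ there is a one-to-one mapping $\theta_{s2}=\Theta_{s2}(\theta_{s1})$ such that $\theta_{s2}$ is the unique parameter value of $S_2$ with $p(\mathbf{x}\mid\theta_{s1},S_1^h)=p(\mathbf{x}\mid\theta_{s2},S_2^h)$. The Jacobian $|\partial\theta_{s1}/\partial\theta_{s2}|$ exists and is non-zero for all values of $\theta_{s1}$. **Marginal likelihood equivalence.** For any two independence-equivalent structures $S_1,S_2$ for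 $\mathbf{X}$ and all values of $\theta_{s1}$: $p(\mathbf{x}\mid\Theta_{s2}(\theta_{s1}),S_2^h)=p(\mathbf{x}\mid\theta_{s1},S_1^h)$ and $p(\theta_{s2}\mid S_2^h)=|\partial\theta_{s1}/\partial\theta_{s2}|\,p(\theta_{s1}\mid S_1^h)$, where $\theta_{s2}=\Theta_{s2}(\theta_{s1})$. *)

(* Defs.v *)
(* MathComp / MathComp-Analysis *)
From HB Require Import structures.
From mathcomp Require Import all_boot all_order all_algebra all_fingroup.
From mathcomp Require Import all_classical all_reals all_analysis.

Set Implicit Arguments.
Unset Strict Implicit.
Unset Printing Implicit Defensive.

Import Order.TTheory GRing.Theory Num.Theory.
Import numFieldNormedType.Exports.

Local Open Scope classical_set_scope.
Local Open Scope ring_scope.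

Section Structures.
Variable n : nat.

Definition arc (Pa : {ffun 'I_n -> {set 'I_n}}) : rel 'I_n :=
  [rel i j | i \in Pa j].

(* [connect] is reflexive, so this also excludes loops *)
Definition acyclic (Pa : {ffun 'I_n -> {set 'I_n}}) : bool :=
  [forall i, forall j, arc Pa i j ==> ~~ connect (arc Pa) j i].

Definition bn_structure := {Pa : {ffun 'I_n -> {set 'I_n}} | acyclic Pa}.

Definition parents (S : bn_structure) (i : 'I_n) : {set 'I_n} := val S i.

Definition complete (S : bn_structure) : Prop :=
  forall i j : 'I_n, i != j -> (i \in parents S j) || (j \in parents S i).

Definition covered_arc (S : bn_structure) (i j : 'I_n) : Prop :=
  i \in parents S j /\ (parents S j :\ i)%SET = parents S i.

Definition covered_arc_reversal (S1 S2 : bn_structure) : Prop :=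
  exists i j : 'I_n,
    [/\ covered_arc S1 i j,
        parents S2 j = (parents S1 j :\ i)%SET,
        parents S2 i = (j |: parents S1 i)%SET &
        forall k, k != i -> k != j -> parents S2 k = parents S1 k].

(* [s i] is the position of node [i] *)
Definition topological_order (S : bn_structure) (s : {perm 'I_n}) : Prop :=
  forall i j : 'I_n, j \in parents S i -> (s j < s i)%N.

End Structures.

Section Independence.
Variables (R : realType) (n : nat).

Section FiniteDistribution.
Variables (Omega : finType) (P : Omega -> R) (X : 'I_n -> Omega -> nat).

Definition is_distribution : Prop :=
  (forall w, 0 <= P w) /\ \sum_w P w = 1.

(* P(X_A = x_A) *)
Definition prob_at (A : {set 'I_n}) (x : 'I_n -> nat) : R :=
  \sum_(w | [forall i in A, X i w == x i]) P w.

(* X_A and X_B are independent given X_C *)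
Definition cond_indep (A B C : {set 'I_n}) : Prop :=
  forall x : 'I_n -> nat,
    prob_at (A :|: B :|: C)%SET x * prob_at C x =
    prob_at (A :|: C)%SET x * prob_at (B :|: C)%SET x.

Definition satisfies_structure (S : bn_structure n) : Prop :=
  forall s : {perm 'I_n}, topological_order S s -> forall i : 'I_n,
    cond_indep [set i]%SET
               [set j | (s j < s i)%N & j \notin parents S i]%SET
               (parents S i).

End FiniteDistribution.

(* The assertions represented by [S] are the basic ones (each node is
   independent of its non-parent predecessors given its parents) together with
   everything they entail, so that the notion does not depend on the choice of
   an ordering; entailment ranges over all finitely-valued random variables. *)
Definition represents (S : bn_structure n) (A B C : {set 'I_n}) : Prop :=
  forall (Omega : finType) (P : Omega -> R) (X : 'I_n -> Omega -> nat),
    is_distribution P -> satisfies_structure P X S -> cond_indep P X A B C.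

Definition independence_equivalent (S1 S2 : bn_structure n) : Prop :=
  forall A B C : {set 'I_n}, represents S1 A B C <-> represents S2 A B C.

End Independence.

(* Iterated Lebesgue integral of [f] over the coordinates listed in [s], the
   remaining coordinates being frozen to those of [v].  By Tonelli, for a
   nonnegative measurable [f] and duplicate-free [s] this is the integral with
   respect to the Lebesgue measure in these coordinates. *)
Fixpoint coord_integral (R : realType) (d : nat) (s : seq 'I_d)
    (f : 'rV[R]_d -> \bar R) (v : 'rV[R]_d) : \bar R :=
  match s with
  | [::] => f v
  | k :: s' =>
      (\int[@lebesgue_measure R]_(x in setT)
         coord_integral s' f (\row_l (if l == k then x else v ord0 l)))%E
  end.

Section Model.
Variables (R : realType) (n : nat).

Definition parent_value (T : 'I_n -> Type) (A : {set 'I_n}) : Type :=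
  forall j : 'I_n, j \in A -> T j.

(* [T i] is the range of X_i; [ref_measure i] is the measure with respect to
   which p(x_i | ...) is a density (counting measure for a discrete variable,
   Lebesgue measure for a continuous one). The local parameter theta_i of S is
   a vector of [dim i A] reals, A being the parent set of X_i in S, with range
   the open set [dom i A]: number and range depend on S only through A, as is
   implicit in comparing the densities of theta_i in two structures in which
   X_i has the same parents. The local likelihood may depend on all of S. *)
Record bn_model := BnModel {
  disp : 'I_n -> measure_display;
  T : forall i, measurableType (disp i);
  ref_measure : forall i, {sigma_finite_measure set (T i) -> \bar R};
  family : forall (i : 'I_n) (A : {set 'I_n}),
    set (T i -> parent_value (fun j => T j) A -> R);
  family_ge0 : forall i A f, @family i A f -> forall xi pa, 0 <= f xi pa;
  family_measurable : forall i A f, @family i A f ->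
    forall pa, measurable_fun [set: T i] (fun xi => f xi pa);
  family_integral : forall i A f, @family i A f ->
    forall pa, (\int[ref_measure i]_(xi in setT) (f xi pa)%:E = 1)%E;
  dim : 'I_n -> {set 'I_n} -> nat;
  dom : forall (i : 'I_n) (A : {set 'I_n}), set 'rV[R]_(dim i A);
  dom_open : forall i A, open (@dom i A);
  local_lik : forall (S : bn_structure n) (i : 'I_n),
    'rV[R]_(dim i (parents S i)) ->
    T i -> parent_value (fun j => T j) (parents S i) -> R;
  local_lik_family : forall S i t,
    @dom i (parents S i) t -> @family i (parents S i) (@local_lik S i t)
}.

Section Likelihood.
Variable M : bn_model.

Definition local_dim (S : bn_structure n) (i : 'I_n) : nat :=
  dim M i (parents S i).

(* theta_s as one row vector; theta_i is its i-th block [submxrow t i] *)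
Definition param (S : bn_structure n) : Type :=
  'rV[R]_(\sum_i local_dim S i).

Definition param_dom (S : bn_structure n) : set (param S) :=
  [set t | forall i, @dom M i (parents S i) (submxrow t i)].

Definition likelihood (S : bn_structure n) (t : param S)
    (x : forall i, T M i) : R :=
  \prod_i @local_lik M S i (submxrow t i) (x i) (fun j _ => x j).

Definition same_likelihood (S1 S2 : bn_structure n)
    (t1 : param S1) (t2 : param S2) : Prop :=
  forall x : (forall i, T M i), likelihood t1 x = likelihood t2 x.

Definition distribution_equivalent (S1 S2 : bn_structure n) : Prop :=
  (forall t1, param_dom (S:=S1) t1 ->
     exists2 t2, param_dom (S:=S2) t2 & same_likelihood t1 t2) /\
  (forall t2, param_dom (S:=S2) t2 ->
     exists2 t1, param_dom (S:=S1) t1 & same_likelihood t1 t2).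

Definition covered_arc_reversal_equivalence : Prop :=
  forall S1 S2 : bn_structure n,
    covered_arc_reversal S1 S2 -> distribution_equivalent S1 S2.

(* Theta_{s2}; meaningful on [param_dom S1] when S1 and S2 are distribution
   equivalent, and 0 where no matching value exists *)
Definition param_map (S1 S2 : bn_structure n) (t1 : param S1) : param S2 :=
  xget (0 : 'rV[R]_(\sum_i local_dim S2 i))
    [set t2 : param S2 | param_dom t2 /\ same_likelihood t1 t2].

(* |d theta_{s1} / d theta_{s2}| at [t2]; the Jacobian matrix is square when S1
   and S2 have equally many parameters, and [conform_mx] only serves to give it
   a square type *)
Definition abs_jacobian (S1 S2 : bn_structure n) (t2 : param S2) : R :=
  `| \det (conform_mx (0 : 'M[R]_(\sum_i local_dim S2 i))
             (jacobian (@param_map S2 S1) t2)) |.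

Record technical_assumptions : Prop := TechnicalAssumptions {
  local_param_unique : forall (S : bn_structure n) (i : 'I_n) t t',
    @dom M i (parents S i) t -> @dom M i (parents S i) t' ->
    (forall xi pa, @local_lik M S i t xi pa = @local_lik M S i t' xi pa) ->
    t = t';
  param_unique : forall S1 S2 : bn_structure n,
    distribution_equivalent S1 S2 ->
    forall t1, param_dom (S:=S1) t1 ->
    exists! t2 : param S2, param_dom t2 /\ same_likelihood t1 t2;
  jacobian_exists : forall S1 S2 : bn_structure n,
    distribution_equivalent S1 S2 ->
    (\sum_i local_dim S1 i = \sum_i local_dim S2 i)%N /\
    forall t1, param_dom (S:=S1) t1 ->
      differentiable (@param_map S2 S1) (param_map S2 t1) /\
      abs_jacobian S1 (param_map S2 t1) != 0
}.

(* [struct_prior S] is p(S^h) and [density S] is p(theta_s | S^h) *)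
Record bn_prior := BnPrior {
  struct_prior : bn_structure n -> R;
  struct_prior_gt0 : forall S, 0 < struct_prior S;
  struct_prior_sum : \sum_S struct_prior S = 1;
  density : forall S : bn_structure n, param S -> R;
  density_ge0 : forall S t, 0 <= @density S t;
  density_dom : forall S t, ~ param_dom t -> @density S t = 0;
  density_measurable : forall S,
    measurable_fun [set: (\sum_i local_dim S i).-tuple R]
      (fun u : (\sum_i local_dim S i).-tuple R =>
         @density S (\row_k tnth u k));
  density_integral : forall S,
    coord_integral (enum 'I_(\sum_i local_dim S i))
      (fun t => (@density S t)%:E) 0 = 1%E
}.

(* A parameter vector of S with i-th block [ti]; its other blocks are arbitrary
   (zero or a copy of [ti], according to their size). *)
Definition with_block (S : bn_structure n) (i : 'I_n)
    (ti : 'rV[R]_(local_dim S i)) : param S :=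
  \mxrow_(j < n) conform_mx (0 : 'rV[R]_(local_dim S j)) ti.

(* p(theta_i | S^h): all coordinates outside block i, i.e. those l with
   [tagnat.sig1 l != i], are integrated out *)
Definition marginal_density (P : bn_prior) (S : bn_structure n) (i : 'I_n)
    (ti : 'rV[R]_(local_dim S i)) : \bar R :=
  coord_integral
    [seq l <- enum 'I_(\sum_j local_dim S j) | tagnat.sig1 l != i]
    (fun t => (density P t)%:E) (with_block ti).

Definition global_parameter_independence (P : bn_prior) : Prop :=
  forall (S : bn_structure n) (t : param S),
    (density P t)%:E =
    (\prod_(i < n) @marginal_density P S i (submxrow t i))%E.

Definition prior_modularity (P : bn_prior) : Prop :=
  forall (S1 S2 : bn_structure n) (i : 'I_n)
    (e : parents S1 i = parents S2 i) (ti : 'rV[R]_(local_dim S1 i)),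
    @marginal_density P S1 i ti =
    @marginal_density P S2 i (castmx (erefl, congr1 (dim M i) e) ti).

Definition marginal_likelihood_equivalence (P : bn_prior) : Prop :=
  forall S1 S2 : bn_structure n, independence_equivalent R S1 S2 ->
  forall t1 : param S1, param_dom t1 ->
    let t2 : param S2 := param_map S2 t1 in
    [/\ param_dom t2,
        (forall x, likelihood t2 x = likelihood t1 x) &
        density P t2 = abs_jacobian S1 t2 * density P t1].

End Likelihood.
End Model.

(* Main.v *)
(** A complete structure represents no independence assertion, so marginal
    likelihood equivalence determines the prior of every complete structure from
    that of one of them, by change of variables.  For any structure [S] and node
    [i] some complete structure gives [i] the same parents as [S] does: order the
    nodes with the parents of [i] first, then [i], then the others.  Its marginal
    density of theta_i is that of [S] by prior modularity, and global parameter
    independence multiplies these marginals into the prior of [S]. *)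
Require Import Defs.
From mathcomp Require Import all_boot all_order all_algebra all_fingroup.
From mathcomp Require Import all_classical all_reals all_analysis.
From mathcomp Require Import zify.

Set Implicit Arguments.
Unset Strict Implicit.
Unset Printing Implicit Defensive.

Import Order.TTheory GRing.Theory Num.Theory.

Local Open Scope ring_scope.

Section CompleteStructures.
Variable n : nat.

Definition rank_parents (rank : 'I_n -> nat) : {ffun 'I_n -> {set 'I_n}} :=
  [ffun k => [set j | (rank j < rank k)%N]%SET].

Lemma arc_rank_parents (rank : 'I_n -> nat) (i j : 'I_n) :
  Defs.arc (rank_parents rank) i j = (rank i < rank j)%N.
Proof. by rewrite /Defs.arc /= /rank_parents ffunE inE. Qed.

(** Ranks increase along arcs, so a path closing an arc into a cycle would bring the rank back below
    its start. *)
Lemma acyclic_rank (rank : 'I_n -> nat) : acyclic (rank_parents rank).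
Proof.
apply/forallP => i; apply/forallP => j; apply/implyP.
rewrite arc_rank_parents => lt_ij; apply/negP => /connectP[p pathp def_i].
suff le_last : (rank j <= rank (last j p))%N.
  by rewrite leqNgt -def_i lt_ij in le_last.
elim: p j pathp {lt_ij def_i} => //= k p IHp j /andP[].
rewrite arc_rank_parents => /ltnW le_jk /IHp; exact: leq_trans.
Qed.

Definition rank_structure (rank : 'I_n -> nat) : bn_structure n :=
  exist _ (rank_parents rank) (acyclic_rank rank).

Lemma parents_rank_structure (rank : 'I_n -> nat) (i : 'I_n) :
  parents (rank_structure rank) i = [set j | (rank j < rank i)%N]%SET.
Proof. by rewrite /parents /= ffunE. Qed.

Lemma complete_rank_structure (rank : 'I_n -> nat) :
  injective rank -> complete (rank_structure rank).
Proof.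
move=> rank_inj i j neq_ij.
by rewrite !parents_rank_structure !inE -neq_ltn (inj_eq rank_inj).
Qed.

Lemma parents_irrefl (S : bn_structure n) (i : 'I_n) : i \notin parents S i.
Proof.
apply/negP => Sii; have /forallP/(_ i)/forallP/(_ i)/implyP := valP S.
by move=> /(_ Sii); rewrite connect0.
Qed.

(** The three cases take values below [n], equal to [n] and above [n], so ranks are distinct and
    exactly the parents of [i] come before [i]. *)
Definition family_rank (S : bn_structure n) (i j : 'I_n) : nat :=
  if j \in parents S i then nat_of_ord j else if j == i then n else (n.+1 + j)%N.

Lemma family_rank_inj (S : bn_structure n) (i : 'I_n) :
  injective (family_rank S i).
Proof.
move=> j k eq_rank; apply: val_inj; move: eq_rank (ltn_ord j) (ltn_ord k).
rewrite /family_rank.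
case: (j \in _); case: (k \in _).
all: by case: (j =P i) => [->|_]; case: (k =P i) => [->|_] //=; lia.
Qed.

Definition family_structure (S : bn_structure n) (i : 'I_n) : bn_structure n :=
  rank_structure (family_rank S i).

Lemma complete_family_structure (S : bn_structure n) (i : 'I_n) :
  complete (family_structure S i).
Proof. exact/complete_rank_structure/family_rank_inj. Qed.

Lemma parents_family_structure (S : bn_structure n) (i : 'I_n) :
  parents S i = parents (family_structure S i) i.
Proof.
apply/setP => j; rewrite parents_rank_structure inE /family_rank.
rewrite (negbTE (parents_irrefl S i)) eqxx.
case: ifP => _; first by rewrite ltn_ord.
by case: eqP => _; rewrite ?ltnn // ltnNge leqW // leq_addr.
Qed.

(** Each predecessor of a node is adjacent to it, hence a parent: every basic assertion concerns the
    empty set and is trivial. *)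
Lemma complete_satisfies (R : realType) (Omega : finType) (P : Omega -> R)
    (X : 'I_n -> Omega -> nat) (S : bn_structure n) :
  complete S -> satisfies_structure P X S.
Proof.
move=> Scomp s s_top i x.
have -> : [set j | (s j < s i)%N & j \notin parents S i]%SET = finset.set0.
  apply/setP => j; rewrite !inE; apply/negP => /andP[lt_ji notSij].
  have neq_ij : i != j by apply: contraTneq lt_ji => ->; rewrite ltnn.
  move: (Scomp i j neq_ij); rewrite (negbTE notSij) orbF => /s_top.
  by rewrite ltnNge ltnW.
by rewrite finset.setU0 finset.set0U.
Qed.

Lemma complete_independence_equivalent (R : realType) (S1 S2 : bn_structure n) :
  complete S1 -> complete S2 -> independence_equivalent R S1 S2.
Proof.
move=> S1comp S2comp A B C.
by split=> repS Omega P X distP _; apply: repS => //; apply: complete_satisfies.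
Qed.

End CompleteStructures.

Section Construction.
Variables (R : realType) (n : nat) (M : bn_model R n).

(** The change-of-variables formula solved for the density on [S]; the value 0 off the domain agrees
    with [density_dom]. *)
Definition transport (Sc S : bn_structure n) (f : param M Sc -> R)
    (t : param M S) : R :=
  if `[< param_dom t >]
  then f (param_map Sc t) / abs_jacobian S (param_map Sc t) else 0.

(** [marginal_density] for an arbitrary function, so that the construction need not mention a prior;
    on [density P] the two are convertible. *)
Definition marginal (S : bn_structure n) (f : param M S -> R) (i : 'I_n)
    (ti : 'rV[R]_(local_dim M S i)) : \bar R :=
  coord_integral
    [seq l <- enum 'I_(\sum_j local_dim M S j) | tagnat.sig1 l != i]
    (fun t => (f t)%:E) (with_block ti).

Definition construct_density (Sc S : bn_structure n) (f : param M Sc -> R)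
    (t : param M S) : R :=
  fine (\prod_(i < n) marginal (transport (S := family_structure S i) f)
    (castmx (erefl, congr1 (Defs.dim M i) (parents_family_structure S i))
       (submxrow t i)))%E.

(** Gives access to the nonvanishing Jacobian of [jacobian_exists]; the matching parameters are the
    images under [param_map], in both directions. *)
Lemma equivalent_distribution (P : bn_prior M) (S1 S2 : bn_structure n) :
  marginal_likelihood_equivalence P -> independence_equivalent R S1 S2 ->
  distribution_equivalent M S1 S2.
Proof.
move=> mleP eqS; have eqS' : independence_equivalent R S2 S1.
  by move=> A B C; apply: iff_sym; apply: eqS.
split=> t dom_t.
  have [dom_t' lik_t' _] := mleP _ _ eqS _ dom_t.
  by exists (param_map S2 t) => // x; rewrite lik_t'.
have [dom_t' lik_t' _] := mleP _ _ eqS' _ dom_t.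
by exists (param_map S1 t).
Qed.

Lemma density_transport (P : bn_prior M) (Sc S : bn_structure n) :
  technical_assumptions M -> marginal_likelihood_equivalence P ->
  independence_equivalent R S Sc ->
  density P (S := S) = transport (density P (S := Sc)).
Proof.
move=> techM mleP eqS; apply: funext => t; rewrite /transport.
case: asboolP => [dom_t|]; last exact: density_dom.
have [_ /(_ t dom_t)[_ jac_neq0]] :=
  jacobian_exists techM (equivalent_distribution mleP eqS).
have [_ _ ->] := mleP _ _ eqS _ dom_t.
by rewrite mulrC mulKf.
Qed.

Lemma density_construct (P : bn_prior M) (Sc S : bn_structure n) :
  technical_assumptions M -> global_parameter_independence P ->
  prior_modularity P -> marginal_likelihood_equivalence P -> complete Sc ->
  density P (S := S) = construct_density (density P (S := Sc)).
Proof.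
move=> techM indepP modP mleP Sc_comp; apply: funext => t.
(* Global independence is an identity in the extended reals, so the real density is first written as
   a [fine]. *)
rewrite -[LHS]/(fine (density P t)%:E) indepP /construct_density.
congr fine; apply: eq_bigr => i _.
(* Modularity moves the [i]-th factor to a complete structure, where the transported density is the
   prior itself. *)
rewrite (modP _ _ _ (parents_family_structure S i)) -density_transport //.
by apply: complete_independence_equivalent => //; exact: complete_family_structure.
Qed.

End Construction.

(* The construction may use the likelihood model, but of the prior it sees only
   the density of the given complete structure. *)
Theorem theorem4 (R : realType) (n : nat) (M : bn_model R n)
    (Hcov : covered_arc_reversal_equivalence M)
    (Htech : technical_assumptions M) :
  exists construct : forall Sc S : bn_structure n,
      (param M Sc -> R) -> (param M S -> R),
  forall P : bn_prior M,
    global_parameter_independence P ->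
    prior_modularity P ->
    marginal_likelihood_equivalence P ->
    forall Sc : bn_structure n, complete Sc ->
    forall S : bn_structure n,
      @density R n M P S = construct Sc S (@density R n M P Sc).
Proof.
exists (@construct_density R n M) => P indepP modP mleP Sc Sc_comp S.
exact: density_construct.
Qed.
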